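(* Let $\mathcal{D}$ be the set of all $f:\mathbb{R}\to\mathbb{R}$ that are twice continuously differentiable and satisfy $|f(x)|\le 1$, $|f'(x)|\le 1$ and $|f''(x)|\le 1$ for all $x\in\mathbb{R}$. Let $Z$ be a standard normal random variable and let $W$ be any real-valued random variable. Then \[ \sup_{t\in\mathbb{R}} |\mathbb{P}(W\le t)-\mathbb{P}(Z\le t)| \le 2\Big(\sup_{f\in\mathcal{D}} |\mathbb{E}(f'(W)-Wf(W))|\Big)^{1/2}. \]
   Context: A standard normal random variable is a Gaussian random variable with mean $0$ and variance $1$. The right-hand side is understood to be $+\infty$ (so the inequality is trivial) when $W$ is not integrable, i.e. when $\mathbb{E}|W|=\infty$. *)

(* Defs.v *)
From HB Require Import structures.
From mathcomp Require Import all_boot all_order all_algebra.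
From mathcomp Require Import all_classical all_reals all_analysis.

Set Implicit Arguments.
Unset Strict Implicit.
Unset Printing Implicit Defensive.

Import Order.TTheory GRing.Theory Num.Theory.
Import numFieldNormedType.Exports.

Local Open Scope classical_set_scope.
Local Open Scope ring_scope.

Definition twice_continuously_differentiable (R : realType) (f : R -> R) : Prop :=
  [/\ forall x : R, derivable f x 1,
      forall x : R, derivable f^`()%classic x 1 &
      continuous f^`(2)%classic ].

Definition stein_class (R : realType) : set (R -> R) :=
  [set f | twice_continuously_differentiable f /\
    forall x : R, [/\ `|f x| <= 1, `|f^`()%classic x| <= 1 & `|f^`(2)%classic x| <= 1] ].

(* Equality is required on measurable sets only: off the Borel sets, neither
   side is a meaningful probability. *)
Definition standard_normal (R : realType) (d : measure_display)
    (T : measurableType d) (P : probability T R) (Z : {RV P >-> R}) : Prop :=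
  forall A : set R, measurable A -> distribution P Z A = normal_prob 0 1 A.

Local Open Scope ereal_scope.

(* The case E|W| = +oo is set apart because the library assigns a value to the
   expectation of a non-integrable function. *)
Definition stein_bound (R : realType) (d : measure_display)
    (T : measurableType d) (P : probability T R) (W : {RV P >-> R}) : \bar R :=
  if 'E_P[fun w => `|W w|%R] == +oo then +oo
  else 2%:E * sqrte (ereal_sup
    [set `| 'E_P[fun w => (f^`()%classic (W w) - W w * f (W w))%R] |
      | f in @stein_class R]).

(* Main.v *)
Require Import Defs.
From HB Require Import structures.
From mathcomp Require Import all_boot all_order all_algebra.
From mathcomp Require Import all_classical all_reals all_analysis.
From mathcomp Require Import measurable_realfun ring lra.

(** Write [phi] and [Phi] for the density and the distribution function of the
    standard normal law, and [S] for the supremum of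
    [|E(f'(W) - W f(W))|] over the class of test functions.

    The proof is Stein's method with an explicit solution. Let [eta] be a
    continuous bump on an interval [[a, b]], with [0 <= eta <= 1], primitive [N]
    and mass [m = N(b) <= 1]. The function [m - N] is a smoothed version of
    [m] times the indicator of a half-line: it is [m] up to [a] and [0] from [b]
    on. Put
      [B(x) = int_{-oo}^x eta Phi],   [A(x) = int_x^{+oo} eta (1 - Phi)],
      [c = B(b) = int eta Phi],
      [f = (Phi / phi) A + ((1 - Phi) / phi) B].
    Then [f' - x f = A - B = (m - N) - c] and
    [f'' = - eta + f + x f'], so that [f] is of class C^2
    ([stein_solution]). The constant [2] leaves room for this construction
    because the bound [1] on [eta] passes to [f] and [f''] without loss, and
    [f'] is bounded by [1] as well:
    - [f] and [f'' + eta] are combinations of [A >= 0] and [B >= 0] with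
      nonnegative coefficients, the positivity for [f'' + eta] being Mills'
      inequality [x phi + (1 + x^2) Phi >= 0] and its mirror image
      ([mills_lower], [mills_upper]);
    - since [eta <= 1], [A <= int_x^{+oo} (1 - Phi) = phi - x (1 - Phi)] and
      [B <= int_{-oo}^x Phi = phi + x Phi], and with these two values the
      combinations are exactly equal to [1]; hence [0 <= f <= 1] and
      [0 <= f'' + eta <= 1], so that [-1 <= f'' <= 1];
    - [f'] is a difference of two nonnegative terms, each at most [1] because
      [A <= 1 - Phi] and [B <= Phi] when [m <= 1].

    So [f] is a test function and [|E(m - N(W)) - c| <= S], where
    [m P(W <= a) <= E(m - N(W)) <= m P(W <= b)] and
    [m Phi(a) <= c <= m Phi(b)]. With the parabolic bump, [m = 2 (b - a) / 3].
    Taking [b - a = x] for [x = |P(W <= t) - Phi(t)|], with [t] at one end of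
    the interval, and [Phi(b) - Phi(a) <= x / 2], this gives
    [(2 x / 3) (x - x / 2) <= S], that is [x^2 <= 3 S], and in particular
    [x <= 2 sqrt S] ([kolmogorov_stein_bound]). *)

Set Implicit Arguments.
Unset Strict Implicit.
Unset Printing Implicit Defensive.

Import Order.TTheory GRing.Theory Num.Theory.
Import numFieldNormedType.Exports.

Local Open Scope classical_set_scope.
Local Open Scope ring_scope.

(** * Calculus *)

Lemma is_derive_continuous (R : realType) (F : R -> R) (x d : R) :
  is_derive x 1 F d -> {for x, continuous F}.
Proof.
by move=> [dF _]; exact/differentiable_continuous/derivable1_diffP.
Qed.

Lemma is_derive_nondecreasing (R : realType) (F dF : R -> R) (x y : R) :
  x <= y ->
  (forall z, x <= z <= y -> is_derive z 1 F (dF z)) ->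
  (forall z, x < z < y -> 0 <= dF z) -> F x <= F y.
Proof.
move=> xy DF dF0.
have [lt_xy|] := ltP x y; last by move=> yx; have -> : x = y by lra.
have [||z zxy E] := @MVT R F dF x y lt_xy.
- move=> z; rewrite in_itv/= => /andP[xz zy]; apply: DF; lra.
- apply: derivable_within_continuous => z; rewrite in_itv/= => xzy.
  by case: (DF z xzy).
rewrite -subr_ge0 E mulr_ge0 ?subr_ge0// dF0//.
Qed.

Lemma is_derive_nonincreasing (R : realType) (F dF : R -> R) (x y : R) :
  x <= y ->
  (forall z, x <= z <= y -> is_derive z 1 F (dF z)) ->
  (forall z, x < z < y -> dF z <= 0) -> F y <= F x.
Proof.
move=> xy DF dF0; rewrite -lerN2.
apply: (@is_derive_nondecreasing R (- F) (- dF)) => // z zxy.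
  by apply: is_deriveN; exact: DF.
by rewrite oppr_ge0; exact: dF0.
Qed.

(** The primitive is the integral from [-oo]. Vanishing to the left of [a] is
    what makes it converge and also normalizes the primitive. *)
Lemma continuous_primitive (R : realType) (h : R -> R) (a : R) :
  continuous h -> (forall x, x <= a -> h x = 0) ->
  exists F : R -> R, (forall x : R, is_derive x 1 F (h x)) /\
    (forall x, x <= a -> F x = 0).
Proof.
move=> ch h0.
pose mu := @lebesgue_measure R.
have hint u : mu.-integrable `]-oo, u] (EFin \o h).
  have : mu.-integrable `[a, u] (EFin \o h).
    apply: continuous_compact_integrable; first exact: segment_compact.
    exact: continuous_subspaceT.
  (* extended by 0, the restrictions of h to [a, u] and to ]-oo, u] agree *)
  rewrite integrable_mkcond// [in X in _ -> X]integrable_mkcond//.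
  congr (mu.-integrable _ _); apply/funext => x; rewrite !patchE.
  have [xa|ax] := leP x a; last first.
    congr (if _ then _ else _); apply/asbool_equiv_eq.
    by rewrite /= !in_itv/= (ltW ax).
  by rewrite /= h0//; case: ifP; case: ifP.
exists (fun x => \int[mu]_(t in `]-oo, x]) h t)%R; split=> [x|x xa].
  have xx1 : x < x + 1 by lra.
  have [D E] := @continuous_FTC1 R h -oo%O x (x + 1) xx1 (hint _)
    (@ltNyr _ x) (ch x).
  by apply: DeriveDef => //; rewrite -derive1E.
rewrite (@eq_Rintegral _ _ _ _ _ (cst 0)) ?Rintegral_cst ?mul0r//.
by move=> t; rewrite inE/= in_itv/= => tx; rewrite h0 ?(le_trans tx).
Qed.

(** This and the next lemma are how the inequalities between [A], [B], [N] and
    the normal distribution are proved: away from the bump, one side of the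
    inequality is explicit, and the sign of the derivative propagates it. *)
Lemma nonincreasing_ge0 (R : realType) (K K' : R -> R) (b : R) :
  (forall x : R, is_derive x 1 K (K' x)) -> (forall x, K' x <= 0) ->
  (forall x, b <= x -> 0 <= K x) -> forall x, 0 <= K x.
Proof.
move=> DK K'0 Kb x; have [bx|xb] := leP b x; first exact: Kb.
apply: (le_trans (Kb b (lexx b))).
by apply: (@is_derive_nonincreasing R K K') => //; exact: ltW.
Qed.

Lemma nondecreasing_ge0 (R : realType) (K K' : R -> R) (a : R) :
  (forall x : R, is_derive x 1 K (K' x)) -> (forall x, 0 <= K' x) ->
  (forall x, x <= a -> 0 <= K x) -> forall x, 0 <= K x.
Proof.
move=> DK K'0 Ka x; have [xa|ax] := leP x a; first exact: Ka.
apply: (le_trans (Ka a (lexx a))).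
by apply: (@is_derive_nondecreasing R K K') => //; exact: ltW.
Qed.

Lemma is_derive_cst_right (R : realType) (F dF : R -> R) (b x : R) :
  (forall x : R, is_derive x 1 F (dF x)) -> (forall x, b <= x -> dF x = 0) ->
  b <= x -> F x = F b.
Proof.
move=> DF dF0 bx; apply/eqP; rewrite eq_le; apply/andP; split.
  apply: (@is_derive_nonincreasing R F dF) => // z /andP[bz _].
  by rewrite dF0// ltW.
apply: (@is_derive_nondecreasing R F dF) => // z /andP[bz _].
by rewrite dF0// ltW.
Qed.

(** * The standard normal distribution *)

Section std_normal.
Variable R : realType.
Implicit Types x y : R.

Local Notation phi := (@normal_pdf R 0 1).

Definition std_cdf x : R := fine (normal_prob 0 1 `]-oo, x]).

Lemma std_pdf_derive x : is_derive x 1 phi (- x * phi x).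
Proof.
have E : phi = normal_peak 1 \*: (expR \o (- 2^-1 \*: (id ^+ 2))).
  apply/funext => y; rewrite normal_pdfE ?oner_neq0//= /normal_fun subr0.
  by rewrite !fctE /= /GRing.scale/= expr1n; congr (_ * expR _); field.
rewrite E; apply: is_derive_eq.
by rewrite !fctE /= /GRing.scale /=; field.
Qed.

Lemma std_pdf_gt0 x : 0 < phi x.
Proof.
rewrite normal_pdfE ?oner_neq0// mulr_gt0 ?expR_gt0// normal_peak_gt0//.
Qed.

(** The maximum of the density is [1 / sqrt (2 pi)], and [2 pi >= 4]. *)
Lemma std_pdf_le_half x : phi x <= 2^-1.
Proof.
apply: (le_trans (normal_pdf_ub _ _ (oner_neq0 _))).
rewrite /normal_peak lef_pV2 ?posrE ?sqrtr_gt0 ?mulrn_wgt0 ?expr1n ?mul1r ?pi_gt0//.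
have -> : 2 = Num.sqrt (2 ^+ 2) :> R by rewrite sqrtr_sqr ger0_norm.
rewrite ler_wsqrtr//.
have := @pi_ge2 R; rewrite -mulr_natr; lra.
Qed.

Lemma std_cdf_derive x : is_derive x 1 std_cdf (phi x).
Proof.
have xx1 : x < x + 1 by lra.
have phi_int : (@lebesgue_measure R).-integrable `]-oo, (x + 1)] (EFin \o phi).
  apply: (@integrableS _ _ _ _ setT) => //.
  exact: integrable_normal_pdf.
have [D E] := @continuous_FTC1 R phi -oo%O x (x + 1) xx1 phi_int (@ltNyr _ x)
  (@continuous_normal_pdf R 0 1 (oner_neq0 _) x).
by apply: DeriveDef => //; rewrite -derive1E.
Qed.

Lemma std_normal_probE x : normal_prob 0 1 `]-oo, x] = (std_cdf x)%:E.
Proof. by rewrite /std_cdf fineK// fin_num_measure. Qed.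

Lemma std_cdf_ge0 x : 0 <= std_cdf x.
Proof. by rewrite -lee_fin -std_normal_probE. Qed.

Lemma std_cdf_le1 x : std_cdf x <= 1.
Proof. by rewrite -lee_fin -std_normal_probE probability_le1. Qed.

Lemma std_cdf_nondecreasing x y : x <= y -> std_cdf x <= std_cdf y.
Proof.
move=> xy; apply: (@is_derive_nondecreasing R std_cdf phi) => // z _.
  exact: std_cdf_derive.
exact/ltW/std_pdf_gt0.
Qed.

Lemma std_cdf_lipschitz x y : x <= y -> std_cdf y - std_cdf x <= (y - x) / 2.
Proof.
move=> xy.
have : (2^-1 \*: id - std_cdf) x <= (2^-1 \*: id - std_cdf) y.
  apply: (@is_derive_nondecreasing R _ (fun z => 2^-1 *: 1 - phi z)) => // z _.
    by apply: is_deriveB; exact: std_cdf_derive.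
  rewrite /GRing.scale/= mulr1 subr_ge0; exact: std_pdf_le_half.
rewrite !fctE /= /GRing.scale/=; lra.
Qed.

End std_normal.

Section mills.
Variable R : realType.
Implicit Types x y : R.

Local Notation phi := (@normal_pdf R 0 1).
Local Notation Phi := (@std_cdf R).

Let idR : measurableTypeR R -> R := idfun.

#[local] HB.instance Definition _ :=
  @isMeasurableFun.Build _ _ _ _ idR (@measurable_id _ _ setT).

Lemma std_cdf_cvgNy0 : Phi @ -oo --> (0 : R).
Proof.
by move: (cvg_cdfNy0 (idR : {RV (normal_prob 0 1) >-> R})) => /fine_cvg.
Qed.

Lemma std_cdf_cvgy1 : Phi @ +oo --> (1 : R).
Proof.
by move: (cvg_cdfy1 (idR : {RV (normal_prob 0 1) >-> R})) => /fine_cvg.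
Qed.

Lemma std_pdfN x : phi (- x) = phi x.
Proof. by rewrite normal_pdfE ?oner_neq0//= /normal_fun !subr0 sqrrN. Qed.

(** The sum [Phi(x) + Phi(- x)] has derivative [phi(x) - phi(- x) = 0], and its
    limit at [+oo] is [1]. *)
Lemma std_cdfN x : Phi (- x) = 1 - Phi x.
Proof.
pose S := Phi + (Phi \o -%R).
have S'0 y : is_derive y 1 S 0.
  have DN : is_derive y 1 (Phi \o -%R) (phi (- y) * - 1).
    exact: (is_derive1_comp (std_cdf_derive (- y)) (is_deriveNid y 1)).
  apply: (is_derive_eq (is_deriveD (std_cdf_derive y) DN)).
  rewrite std_pdfN; lra.
have S1 : S y @[y --> +oo] --> (1 + 0 : R).
  apply: cvgD; first exact: std_cdf_cvgy1.
  by have := std_cdf_cvgNy0; rewrite cvgNy_compNP.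
have : S y @[y --> +oo] --> S x.
  apply: cvg_near_cst; apply: nearW => y.
  by rewrite (is_derive_0_is_cst y x S'0).
move=> /(cvg_unique (@Rhausdorff R) S1); rewrite addr0 => S1x.
have {}S1x : 1 = Phi x + Phi (- x) by rewrite S1x.
by rewrite S1x addrAC subrr add0r.
Qed.

(** The right-hand side is [int_{-oo}^x Phi]. For [x < 0] the claim is that
    [Phi(x) + phi(x) / x <= 0]: this function has derivative
    [- phi(x) / x^2 <= 0] and lies below [Phi], which tends to [0] at [-oo]. *)
Lemma std_pdf_addx_cdf_ge0 x : 0 <= phi x + x * Phi x.
Proof.
have [x0|x0] := leP 0 x.
  by rewrite addr_ge0 ?mulr_ge0 ?std_cdf_ge0// ltW// std_pdf_gt0.
have k0 : Phi x + phi x / x <= 0.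
  apply: (cvgr_to_ge std_cdf_cvgNy0) => /=; near=> y.
  have yx : y < x by near: y; exact/nbhs_ninfty_lt/num_real.
  apply: (@le_trans _ _ (Phi y + phi y / y)).
    have Dk z : y <= z <= x -> is_derive z 1 (Phi + phi * (fun t => t^-1))
        (- (phi z / z ^+ 2)).
      move=> zxy.
      have z0 : z != 0 by rewrite lt_eqF//; lra.
      have DV := is_deriveV z0 (is_derive_id z 1).
      apply: (is_derive_eq (is_deriveD (std_cdf_derive z)
        (is_deriveM (std_pdf_derive z) DV))).
      by rewrite /GRing.scale /=; field.
    apply: (is_derive_nonincreasing (ltW yx) Dk) => z _.
    by rewrite oppr_le0 divr_ge0 ?sqr_ge0// ltW// std_pdf_gt0.
  rewrite gerDl mulr_ge0_le0 ?ltW ?std_pdf_gt0 ?invr_lt0 //; lra.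
have -> : phi x + x * Phi x = x * (Phi x + phi x / x).
  by field; rewrite lt_eqF.
by rewrite mulr_le0 // ltW.
Unshelve. all: by end_near. Qed.

Lemma std_pdf_subx_cdfC_ge0 x : 0 <= phi x - x * (1 - Phi x).
Proof. by have := std_pdf_addx_cdf_ge0 (- x); rewrite std_pdfN std_cdfN mulNr. Qed.

(** Mills' inequality: [Phi(x) + x phi(x) / (1 + x^2)] has derivative
    [2 phi(x) / (1 + x^2)^2 >= 0], and for [y < 0] it is at least
    [y phi(y) / (1 + y^2) >= 1 / y], which tends to [0] at [-oo]. The right-hand
    side is [phi(x)] times the second derivative of [Phi / phi]. *)
Lemma mills_lower x : 0 <= x * phi x + (1 + x ^+ 2) * Phi x.
Proof.
pose D (z : R) := 1 + z ^+ 2.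
have D0 z : 0 < D z by rewrite /D ltr_pwDl// sqr_ge0.
pose h := Phi + (id * phi) * (fun z => (D z)^-1).
have Dh (z : R) : is_derive z 1 h (2 * phi z / D z ^+ 2).
  have z0 : D z != 0 by rewrite gt_eqF.
  have DD : is_derive z 1 D (2 * z).
    apply: (is_derive_eq (is_deriveD (is_derive_cst (1 : R) z 1)
      (is_deriveX 2 (is_derive_id z 1)))).
    by rewrite /GRing.scale /=; ring.
  have DV := is_deriveV z0 DD.
  apply: (is_derive_eq (is_deriveD (std_cdf_derive z)
    (is_deriveM (is_deriveM (is_derive_id z 1) (std_pdf_derive z)) DV))).
  by rewrite /GRing.scale /= !fctE /D; field; exact: z0.
have h_incr y z : y <= z -> h y <= h z.
  move=> yz; apply: (is_derive_nondecreasing yz (fun t _ => Dh t)) => t _.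
  by rewrite divr_ge0 ?sqr_ge0 ?mulr_ge0 ?ltW ?std_pdf_gt0.
have h_lower y : y < 0 -> y^-1 <= h y.
  move=> y0.
  have hy : y * phi y / D y <= h y by rewrite lerDr std_cdf_ge0.
  apply: le_trans hy.
  rewrite ler_pdivlMr//.
  have y2 : y^-1 * D y = y + y^-1 by rewrite /D; field; rewrite lt_eqF.
  have yV0 : y^-1 < 0 by rewrite invr_lt0.
  have phi1 : 0 <= 1 - phi y by have := std_pdf_le_half y; lra.
  rewrite y2; nra.
have h0 : 0 <= h x.
  apply/ler_addgt0Pr => e e0.
  pose y := Num.min x (- e^-1).
  have eV0 : 0 < e^-1 by rewrite invr_gt0.
  have yx : y <= x by rewrite ge_min lexx.
  have ye : y <= - e^-1 by rewrite ge_min lexx orbT.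
  have y0 : y < 0 by lra.
  have : - e <= y^-1.
    by rewrite -[e]invrK -invrN lef_nV2// ?negrE// oppr_lt0.
  have := h_lower _ y0; have := h_incr _ _ yx; lra.
have -> : x * phi x + (1 + x ^+ 2) * Phi x = D x * h x.
  rewrite /h /D !fctE; field; rewrite gt_eqF//; exact: D0.
by rewrite mulr_ge0// ltW.
Qed.

Lemma mills_upper x : 0 <= - (x * phi x) + (1 + x ^+ 2) * (1 - Phi x).
Proof.
by have := mills_lower (- x); rewrite std_pdfN std_cdfN mulNr sqrrN.
Qed.

End mills.

(** * Stein's equation for a smoothed indicator *)

Lemma stein_classP (R : realType) (f f1 f2 : R -> R) :
  (forall x : R, is_derive x 1 f (f1 x)) ->
  (forall x : R, is_derive x 1 f1 (f2 x)) ->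
  continuous f2 ->
  (forall x, [/\ `|f x| <= 1, `|f1 x| <= 1 & `|f2 x| <= 1]) ->
  stein_class f /\ f^`()%classic = f1.
Proof.
move=> Df Df1 cf2 bnd.
have E1 : f^`()%classic = f1 by apply/funext => x; rewrite derive1E derive_val.
have E2 : f1^`()%classic = f2.
  by apply/funext => x; rewrite derive1E derive_val.
split=> //; rewrite /stein_class /twice_continuously_differentiable /= E1 E2.
by [].
Qed.

(** The three bounds on the Stein solution at a point [x]. Here [p], [a] and [q]
    stand for [phi x], [Phi x] and [1 - Phi x]; [A] and [B] are the integrals of
    [eta (1 - Phi)] to the right of [x] and of [eta Phi] to its left. *)
Section bounds.
Variables (R : realFieldType) (x p a q A B : R).
Hypotheses (p0 : 0 < p) (a0 : 0 <= a) (q0 : 0 <= q) (aq : a + q = 1).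
Hypotheses (A0 : 0 <= A) (B0 : 0 <= B).
Hypotheses (Au : A <= p - x * q) (Bu : B <= p + x * a).

(** If [A] and [B] are replaced by their upper bounds, the combination becomes
    [a + q = 1]. *)
Lemma stein_solution_bound : 0 <= a / p * A + q / p * B <= 1.
Proof.
have -> : a / p * A + q / p * B = (a * A + q * B) / p.
  by field; rewrite gt_eqF.
rewrite divr_ge0 ?addr_ge0 ?mulr_ge0 ?(ltW p0)//= ler_pdivrMr// mul1r.
have <- : a * (p - x * q) + q * (p + x * a) = p.
  by rewrite -[RHS]mul1r -aq; ring.
by rewrite lerD// ler_wpM2l.
Qed.

(** The expression is [((p + x a) A - (p - x q) B) / p], a difference of
    nonnegative terms, and [(p + x a) q = p - a (p - x q) <= p]. *)
Lemma stein_solution_derive_bound : A <= q -> B <= a ->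
  `|A - B + x * (a / p * A + q / p * B)| <= 1.
Proof.
move=> Aq Ba.
have -> : A - B + x * (a / p * A + q / p * B) =
  ((p + x * a) * A - (p - x * q) * B) / p.
  have qE : q = 1 - a by rewrite -aq addrAC subrr add0r.
  by rewrite qE; field; rewrite gt_eqF.
have u0 : 0 <= p + x * a by exact: le_trans Bu.
have v0 : 0 <= p - x * q by exact: le_trans Au.
have H1 : (p + x * a) * A <= p.
  apply: (le_trans (ler_wpM2l u0 Aq)).
  have -> : (p + x * a) * q = p * (a + q) - a * (p - x * q) by ring.
  by rewrite aq mulr1 lerBlDr lerDl mulr_ge0.
have H2 : (p - x * q) * B <= p.
  apply: (le_trans (ler_wpM2l v0 Ba)).
  have -> : (p - x * q) * a = p * (a + q) - q * (p + x * a) by ring.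
  by rewrite aq mulr1 lerBlDr lerDl mulr_ge0.
rewrite normrM [X in _ * X]gtr0_norm ?invr_gt0// ler_pdivrMr// mul1r ler_norml.
have := mulr_ge0 u0 A0; have := mulr_ge0 v0 B0; lra.
Qed.

(** Apart from [- eta], the expression is a combination of [A] and [B] whose
    coefficients are nonnegative by Mills' inequality; if [A] and [B] are
    replaced by their upper bounds, it becomes [1]. *)
Lemma stein_solution_derive2_bound (eta : R) :
  0 <= x * p + (1 + x ^+ 2) * a -> 0 <= - (x * p) + (1 + x ^+ 2) * q ->
  0 <= eta <= 1 ->
  `|- eta + (a / p * A + q / p * B) +
     x * (A - B + x * (a / p * A + q / p * B))| <= 1.
Proof.
move=> M1 M2 eta01.
set M1' := (X in 0 <= X) in M1; set M2' := (X in 0 <= X) in M2.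
have -> : - eta + (a / p * A + q / p * B) +
    x * (A - B + x * (a / p * A + q / p * B)) =
    - eta + (M1' * A + M2' * B) / p.
  by rewrite /M1' /M2'; field; rewrite gt_eqF.
have pp : M1' * (p - x * q) + M2' * (p + x * a) = p.
  have qE : q = 1 - a by rewrite -aq addrAC subrr add0r.
  by rewrite /M1' /M2' qE; ring.
have H0 : 0 <= (M1' * A + M2' * B) / p.
  by rewrite divr_ge0 ?(ltW p0)// addr_ge0// mulr_ge0.
have H1 : (M1' * A + M2' * B) / p <= 1.
  by rewrite ler_pdivrMr// mul1r -[leRHS]pp lerD// ler_wpM2l.
rewrite ler_norml; lra.
Qed.
End bounds.

Section solution.
Variables (R : realType) (a b : R) (eta N : R -> R).
Hypotheses (ceta : continuous eta).
Hypotheses (eta01 : forall x, 0 <= eta x <= 1).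
Hypotheses (eta_left : forall x, x <= a -> eta x = 0).
Hypotheses (eta_right : forall x, b <= x -> eta x = 0).
Hypotheses (DN : forall x : R, is_derive x 1 N (eta x)).
Hypotheses (N_left : forall x, x <= a -> N x = 0).
Hypotheses (N1 : N b <= 1).

Local Notation phi := (@normal_pdf R 0 1).
Local Notation Phi := (@std_cdf R).

(** The solution of Stein's equation for the smoothed indicator [N b - N]. The
    constant [c = int eta Phi] is the normal expectation of [N b - N]; only its
    position between the values of [N b * Phi] at [a] and [b] matters. *)
Lemma stein_solution : exists (f : R -> R) (c : R),
  [/\ stein_class f, N b * Phi a <= c <= N b * Phi b &
      forall x, f^`()%classic x - x * f x = N b - N x - c].
Proof.
have cPhi : continuous Phi.
  by move=> x; exact: is_derive_continuous (std_cdf_derive x).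
have [B [DB B_left]] : exists B : R -> R,
    (forall x : R, is_derive x 1 B (eta x * Phi x)) /\
    (forall x, x <= a -> B x = 0).
  apply: continuous_primitive => [x|x xa].
    by apply: cvgM; [exact: ceta|exact: cPhi].
  by rewrite eta_left// mul0r.
have eta0 x : 0 <= eta x by case/andP: (eta01 x).
have eta1 x : eta x <= 1 by case/andP: (eta01 x).
have Phi0 := @std_cdf_ge0 R.
have Phi1 x : 0 <= 1 - Phi x by rewrite subr_ge0 std_cdf_le1.
have phi0 x : 0 <= phi x by exact: normal_pdf_ge0.
have N_right x : b <= x -> N x = N b by exact: (is_derive_cst_right DN eta_right).
have B_right x : b <= x -> B x = B b.
  apply: (is_derive_cst_right DB) => y bdy; by rewrite eta_right// mul0r.
have N_ge0 : forall x, 0 <= N x.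
  apply: (nondecreasing_ge0 (a := a) DN eta0) => x xa; by rewrite N_left.
have N_le x : N x <= N b.
  have [bx|xb] := leP b x; first by rewrite N_right.
  by apply: (is_derive_nondecreasing (ltW xb)) => // *; exact: DN.
have m1 := N1; set m := N b in m1 N_right N_le *; set c := B b in B_right *.
(* A is the integral of eta (1 - Phi) from x to +oo, since N' = eta and
   B' = eta Phi *)
pose A : R -> R := cst (m - c) - N + B.
have DA (x : R) : is_derive x 1 A (- (eta x * (1 - Phi x))).
  apply: (is_derive_eq (is_deriveD
    (is_deriveB (is_derive_cst (m - c) x 1) (DN x)) (DB x))).
  by ring.
have DQ (x : R) : is_derive x 1 (cst 1 - Phi) (0 - phi x).
  exact: (is_deriveB (is_derive_cst (1 : R) x 1) (std_cdf_derive x)).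
have A_right x : b <= x -> A x = 0.
  by move=> bx; rewrite /A !fctE N_right// B_right//; ring.
have A_ge0 : forall x, 0 <= A x.
  apply: (nonincreasing_ge0 (b := b) DA) => [x|x bx]; last by rewrite A_right.
  by rewrite oppr_le0 mulr_ge0.
have B_ge0 : forall x, 0 <= B x.
  apply: (nondecreasing_ge0 (a := a) DB) => [x|x bx]; last by rewrite B_left.
  by rewrite mulr_ge0.
have A_lip x : A x <= phi x - x * (1 - Phi x).
  rewrite -subr_ge0.
  pose K : R -> R := phi - id * (cst 1 - Phi) - A.
  have DK (y : R) : is_derive y 1 K (- ((1 - eta y) * (1 - Phi y))).
    apply: (is_derive_eq (is_deriveB (is_deriveB (std_pdf_derive y)
      (is_deriveM (is_derive_id y 1) (DQ y))) (DA y))).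
    by rewrite /GRing.scale /= !fctE; ring.
  apply: (nonincreasing_ge0 (b := b) DK) => [y|y xb].
    by rewrite oppr_le0 mulr_ge0// subr_ge0.
  by rewrite /K !fctE A_right// subr0; exact: std_pdf_subx_cdfC_ge0.
have B_lip x : B x <= phi x + x * Phi x.
  rewrite -subr_ge0.
  pose K : R -> R := phi + id * Phi - B.
  have DK (y : R) : is_derive y 1 K ((1 - eta y) * Phi y).
    apply: (is_derive_eq (is_deriveB (is_deriveD (std_pdf_derive y)
      (is_deriveM (is_derive_id y 1) (std_cdf_derive y))) (DB y))).
    by rewrite /GRing.scale /= ; ring.
  apply: (nondecreasing_ge0 (a := a) DK) => [y|y xb].
    by rewrite mulr_ge0// subr_ge0.
  by rewrite /K !fctE B_left// subr0; exact: std_pdf_addx_cdf_ge0.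
have A_le x : A x <= 1 - Phi x.
  (* A(x) is an integral of 1 - Phi over [x, +oo[ against a mass m - N x,
     and 1 - Phi decreases *)
  apply: (@le_trans _ _ ((m - N x) * (1 - Phi x))); last first.
    rewrite ler_piMl//; have := N_ge0 x; lra.
  rewrite -subr_ge0.
  pose K : R -> R := (cst m - N) * (cst 1 - Phi) - A.
  have DK (y : R) : is_derive y 1 K (- ((m - N y) * phi y)).
    apply: (is_derive_eq (is_deriveB (is_deriveM
      (is_deriveB (is_derive_cst m y 1) (DN y)) (DQ y)) (DA y))).
    by rewrite /GRing.scale /= !fctE; ring.
  apply: (nonincreasing_ge0 (b := b) DK) => [y|y xb].
    by rewrite oppr_le0 mulr_ge0// subr_ge0.
  by rewrite /K !fctE A_right// N_right// subrr mul0r subr0.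
have B_le x : B x <= Phi x.
  apply: (@le_trans _ _ (N x * Phi x)); last first.
    by rewrite ler_piMl// (le_trans (N_le x)).
  rewrite -subr_ge0.
  pose K : R -> R := N * Phi - B.
  have DK (y : R) : is_derive y 1 K (N y * phi y).
    apply: (is_derive_eq (is_deriveB (is_deriveM (DN y) (std_cdf_derive y))
      (DB y))).
    by rewrite /GRing.scale /= ; ring.
  apply: (nondecreasing_ge0 (a := a) DK) => [y|y xb].
    by rewrite mulr_ge0.
  by rewrite /K !fctE N_left// B_left// mul0r subr0.
pose f : R -> R := (Phi * (fun x => (phi x)^-1)) * A +
  ((cst 1 - Phi) * (fun x => (phi x)^-1)) * B.
pose f1 : R -> R := A - B + id * f.
(* f' and f'' in the form given by the equation itself: both are then visibly
   continuous, and no second derivative has to be computed *)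
pose f2 : R -> R := fun x => - eta x + f x + x * f1 x.
have Df (x : R) : is_derive x 1 f (f1 x).
  have px0 : phi x != 0 by rewrite gt_eqF// std_pdf_gt0.
  have DV := is_deriveV px0 (std_pdf_derive x).
  apply: (is_derive_eq (is_deriveD
    (is_deriveM (is_deriveM (std_cdf_derive x) DV) (DA x))
    (is_deriveM (is_deriveM (DQ x) DV) (DB x)))).
  rewrite /f1 /f /GRing.scale /= !fctE /cst.
  by field.
have Df1 (x : R) : is_derive x 1 f1 (f2 x).
  apply: (is_derive_eq (is_deriveD (is_deriveB (DA x) (DB x))
    (is_deriveM (is_derive_id x 1) (Df x)))).
  by rewrite /f2 /f1 /GRing.scale /=; ring.
have cf2 : continuous f2.
  move=> x; apply: cvgD.
    apply: cvgD; first by apply: cvgN; exact: ceta.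
    exact: is_derive_continuous (Df x).
  by apply: cvgM; [exact: cvg_id|exact: is_derive_continuous (Df1 x)].
have Phi_sum x : Phi x + (1 - Phi x) = 1 by rewrite addrC subrK.
have bounds x : [/\ `|f x| <= 1, `|f1 x| <= 1 & `|f2 x| <= 1].
  split.
  - have /andP[f0 fle] := stein_solution_bound (std_pdf_gt0 x) (Phi0 x)
      (Phi1 x) (Phi_sum x) (A_ge0 x) (B_ge0 x) (A_lip x) (B_lip x).
    by rewrite ger0_norm.
  - exact: (stein_solution_derive_bound (std_pdf_gt0 x) (Phi0 x)
      (Phi1 x) (Phi_sum x) (A_ge0 x) (B_ge0 x) (A_lip x) (B_lip x)).
  - exact: (stein_solution_derive2_bound (std_pdf_gt0 x)
      (Phi_sum x) (A_ge0 x) (B_ge0 x) (A_lip x) (B_lip x)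
      (mills_lower x) (mills_upper x) (eta01 x)).
have [fS f'E] := stein_classP Df Df1 cf2 bounds.
exists f, c; split=> // [|x]; last first.
  by rewrite f'E /f1 /A !fctE; ring.
apply/andP; split.
  rewrite -subr_ge0.
  pose K : R -> R := B - Phi a \*: N.
  have DK (y : R) : is_derive y 1 K (eta y * (Phi y - Phi a)).
    apply: (is_derive_eq (is_deriveB (DB y) (is_deriveZ (Phi a) (DN y)))).
    by rewrite /GRing.scale /=; ring.
  have -> : c - m * Phi a = K b by rewrite /K !fctE /= /GRing.scale /= mulrC.
  apply: (nondecreasing_ge0 (a := a) DK) => [y|y ya]; last first.
    by rewrite /K !fctE /= B_left// N_left// scaler0 subr0.
  have [ya|ay] := leP y a; first by rewrite eta_left// mul0r.
  by rewrite mulr_ge0// subr_ge0 std_cdf_nondecreasing// ltW.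
rewrite -subr_ge0.
pose K : R -> R := Phi b \*: N - B.
have DK (y : R) : is_derive y 1 K (eta y * (Phi b - Phi y)).
  apply: (is_derive_eq (is_deriveB (is_deriveZ (Phi b) (DN y)) (DB y))).
  by rewrite /GRing.scale /=; ring.
have -> : m * Phi b - c = K b by rewrite /K !fctE /= /GRing.scale /= mulrC.
apply: (nondecreasing_ge0 (a := a) DK) => [y|y ya]; last first.
  by rewrite /K !fctE /= B_left// N_left// scaler0 subr0.
have [yb|ay] := leP b y; first by rewrite eta_right// mul0r.
by rewrite mulr_ge0// subr_ge0 std_cdf_nondecreasing// ltW.
Qed.
End solution.

Local Notation Phi := (@std_cdf _).

(** The bump is [4 (x - a) (b - x) / (b - a)^2] between [a] and [b]; it reaches
    its maximum [1] at the midpoint. A parabola gives a mass of two thirds of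
    the length, where a triangular bump would give one half. *)
Lemma parabolic_bump (R : realType) (a b : R) : a < b ->
  exists eta N : R -> R,
  [/\ continuous eta, forall x, 0 <= eta x <= 1,
      (forall x, x <= a -> eta x = 0) /\ (forall x, b <= x -> eta x = 0),
      (forall x : R, is_derive x 1 N (eta x)) /\
      (forall x, x <= a -> N x = 0) &
      N b = 2 / 3 * (b - a)].
Proof.
move=> ab; have ba0 : 0 < (b - a) ^+ 2 by rewrite exprn_gt0// subr_gt0.
pose q x := 4 / (b - a) ^+ 2 * ((x - a) * (b - x)).
have k0 : 0 < 4 / (b - a) ^+ 2 by rewrite divr_gt0.
pose eta x := Num.max 0 (q x).
have eta_in x : a <= x <= b -> eta x = q x.
  move=> /andP[ax xb]; apply/max_idPr; rewrite mulr_ge0 ?(ltW k0)//.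
  by rewrite mulr_ge0 ?subr_ge0.
have eta_left x : x <= a -> eta x = 0.
  move=> xa; apply/max_idPl; rewrite pmulr_rle0// mulr_le0_ge0//; lra.
have eta_right x : b <= x -> eta x = 0.
  move=> bx; apply/max_idPl; rewrite pmulr_rle0// mulr_ge0_le0//; lra.
have ceta : continuous eta.
  move=> x; apply: (@continuous_max R R (cst 0) q); first exact: cvg_cst.
  apply: cvgM; first exact: cvg_cst.
  by apply: cvgM; apply: cvgB; (exact: cvg_cst || exact: cvg_id).
have eta01 x : 0 <= eta x <= 1.
  rewrite le_max lexx/= ge_max ler01/= /q mulrAC ler_pdivrMr// mul1r.
  rewrite -subr_ge0.
  have -> : (b - a) ^+ 2 - 4 * ((x - a) * (b - x)) = (a + b - 2 * x) ^+ 2 by ring.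
  exact: sqr_ge0.
have [N [DN N_left]] := continuous_primitive ceta eta_left.
exists eta, N; split=> //.
(* the polynomial primitive of the parabola, to be compared with N *)
pose p : R -> R := fun x => 4 / (b - a) ^+ 2 *
  ((b - a) / 2 * (x - a) ^+ 2 - 3^-1 * (x - a) ^+ 3).
have Dp (x : R) : is_derive x 1 p (q x).
  have Dx : is_derive x 1 (id - cst a) 1.
    apply: (is_derive_eq (is_deriveB (is_derive_id x 1) (is_derive_cst a x 1))).
    by rewrite subr0.
  have pE : p = 4 / (b - a) ^+ 2 \*:
      ((b - a) / 2 \*: (id - cst a) ^+ 2 - 3^-1 \*: (id - cst a) ^+ 3).
    by apply/funext => y; rewrite !fctE.
  rewrite pE; apply: (is_derive_eq (is_deriveZ _ (is_deriveB
    (is_deriveZ _ (is_deriveX 2 Dx)) (is_deriveZ _ (is_deriveX 3 Dx))))).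
  by rewrite /q /GRing.scale /= !fctE; field; rewrite subr_eq0 gt_eqF.
have DK (x : R) : is_derive x 1 (N - p) (eta x - q x).
  exact: (is_deriveB (DN x) (Dp x)).
have eta_q x : a < x < b -> eta x - q x = 0.
  by move=> /andP[ax xb]; rewrite eta_in ?subrr// !ltW.
have Kab : (N - p) b = (N - p) a.
  apply/eqP; rewrite eq_le; apply/andP; split.
    by apply: (is_derive_nonincreasing (ltW ab) (fun x _ => DK x)) => x /eta_q->.
  by apply: (is_derive_nondecreasing (ltW ab) (fun x _ => DK x)) => x /eta_q->.
have -> : N b = p b + (N a - p a).
  have {}Kab : N b - p b = N a - p a := Kab.
  by rewrite -Kab [RHS]addrC subrK.
by rewrite N_left// /p; field; rewrite subr_eq0 gt_eqF.
Qed.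

(** The form of the Stein solution used for random variables: [h] is squeezed
    between [m] times the indicators of [x <= a] and of [x <= b]. The length of
    the interval is at most [1] so that the mass of the bump is too. *)
Lemma stein_smoothed_indicator (R : realType) (a b : R) : a < b <= a + 1 ->
  let m := 2 / 3 * (b - a) in
  exists (f h : R -> R) (c : R),
  [/\ stein_class f,
      forall x, f^`()%classic x - x * f x = h x - c,
      m * Phi a <= c <= m * Phi b,
      continuous h /\ (forall x, 0 <= h x <= m) &
      (forall x, x <= a -> h x = m) /\ (forall x, b <= x -> h x = 0)].
Proof.
move=> /andP[ab ba1] m.
have [eta [N [ceta eta01 [eta_left eta_right] [DN N_left] Nb]]] :=
  parabolic_bump ab.
have N1 : N b <= 1 by rewrite Nb; lra.
have [f [c [fS cm fE]]] := stein_solution ceta eta01 eta_left eta_right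
  DN N_left N1.
have N_ge0 : forall x, 0 <= N x.
  apply: (nondecreasing_ge0 (a := a) DN) => x; last by move=> /N_left->.
  by case/andP: (eta01 x).
have N_right x : b <= x -> N x = m.
  by rewrite /m -Nb; exact: (is_derive_cst_right DN eta_right).
have N_le x : N x <= m.
  have [bx|xb] := leP b x; first by rewrite N_right.
  rewrite -(N_right _ (lexx b)).
  apply: (is_derive_nondecreasing (ltW xb) (fun y _ => DN y)) => y _.
  by case/andP: (eta01 y).
rewrite Nb -/m in fE cm.
exists f, (fun x => m - N x), c; split=> //; split=> x.
- apply: cvgB; [exact: cvg_cst|exact: is_derive_continuous (DN x)].
- by rewrite subr_ge0 N_le/= gerBl.
- by move=> xa; rewrite N_left// subr0.
- by move=> bx; rewrite N_right// subrr.
Qed.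

(** * Comparison of distribution functions *)

Lemma stein_class0 (R : realType) : @stein_class R (cst 0).
Proof.
have D0 (y : R) := is_derive_cst (0 : R) y 1.
have [] // := stein_classP D0 D0 (fun=> cvg_cst _).
by move=> y; rewrite normr0.
Qed.

Section comparison.
Context (R : realType) (d : measure_display) (T : measurableType d)
  (P : probability T R) (W : {RV P >-> R}).

Local Notation F t := (fine (P [set w | W w <= t])).

Lemma measurable_RV_le t : measurable [set w | W w <= t].
Proof.
rewrite (_ : [set _ | _] = W @^-1` `]-oo, t]); last first.
  by apply/seteqP; split=> w /=; rewrite in_itv.
exact: measurable_funPTI.
Qed.

Lemma RV_le_fineK t : (F t)%:E = P [set w | W w <= t].
Proof. by rewrite fineK// fin_num_measure//; exact: measurable_RV_le. Qed.

Lemma bounded_Lfun1 (X : T -> R) (M : R) : measurable_fun setT X ->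
  (forall w, 0 <= X w <= M) -> X \in Lfun P 1.
Proof.
move=> mX XM; apply/Lfun1_integrable.
apply: measurable_bounded_integrable => //.
  by rewrite (le_lt_trans (probability_le1 _ _)) ?ltry.
exists M; split; first exact: num_real.
move=> y My w _ /=; have /andP[X0 XleM] := XM w.
by rewrite ger0_norm// (le_trans XleM)// ltW.
Qed.

Lemma expectation_between (X : T -> R) (m a b : R) : 0 <= m ->
  measurable_fun setT X -> (forall w, 0 <= X w <= m) ->
  (forall w, W w <= a -> X w = m) -> (forall w, b <= W w -> X w = 0) ->
  m * F a <= fine 'E_P[X] <= m * F b.
Proof.
move=> m0 mX Xm Xa Xb.
have X0 w : 0 <= X w by case/andP: (Xm w).
have XL := bounded_Lfun1 mX Xm.
have Efin := expectation_fin_num XL.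
have mI t : measurable_fun setT (m \o* \1_[set w | W w <= t] : T -> R).
  apply: measurable_funM => //; apply: measurable_indic; exact: measurable_RV_le.
have EI t : 'E_P[m \o* \1_[set w | (W w <= t)%R]]%E = (m * F t)%:E.
  rewrite expectationZl.
    by rewrite expectation_indic ?EFinM ?RV_le_fineK//; exact: measurable_RV_le.
  apply: (@bounded_Lfun1 _ 1).
    by apply: measurable_indic; exact: measurable_RV_le.
  by move=> w; rewrite indicE ler0n lern1 leq_b1.
have I0 t w : 0 <= (m \o* \1_[set w | W w <= t] : T -> R) w.
  by rewrite /= mulr_ge0// indicE ler0n.
apply/andP; split; rewrite -lee_fin fineK// -EI; apply: expectation_le => //.
  apply: nearW => w; rewrite /= indicE.
  have [Wa|Wa] := leP (W w) a.
    by rewrite Xa// mem_set// mul1r.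
  by rewrite memNset ?mul0r// => /=; apply/negP; rewrite -ltNge.
apply: nearW => w; rewrite /= indicE.
have [Wb|Wb] := leP (W w) b.
  by rewrite mem_set// mul1r; case/andP: (Xm w).
by rewrite Xb ?mulr_ge0 ?ler0n// ltW.
Qed.

(** Applying the hypothesis to the test function of [stein_smoothed_indicator]
    gives [|E(h(W)) - c| <= s], where [h] and [c] compare the two distribution
    functions at [a] and [b]. *)
Lemma stein_comparison (s a b : R) : a < b <= a + 1 ->
  (forall f, @stein_class R f ->
    (`| 'E_P[fun w => (f^`()%classic (W w) - W w * f (W w))%R] | <= s%:E)%E) ->
  2 / 3 * (b - a) * (F a - Phi b) <= s /\ 2 / 3 * (b - a) * (Phi a - F b) <= s.
Proof.
move=> ab steins.
have [f [h [c]]] := stein_smoothed_indicator ab.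
set m := 2 / 3 * (b - a); move=> [fS fE /andP[cl cu] [ch hm] [ha hb]].
have m0 : 0 <= m by rewrite /m; move: ab => /andP[]; lra.
have mX : measurable_fun setT (h \o W).
  by apply: measurableT_comp => //; exact: continuous_measurable_fun.
have XL := bounded_Lfun1 mX (fun w => hm (W w)).
have := steins f fS.
have -> : (fun w => f^`()%classic (W w) - W w * f (W w)) = (h \o W) \- cst c.
  by apply/funext => w; rewrite fE.
rewrite expectationB ?Lfun_cst// expectation_cst.
rewrite -(fineK (expectation_fin_num XL)) -EFinB abse_EFin lee_fin ler_norml.
move=> /andP[sl su].
have /andP[El Eu] := @expectation_between (h \o W) m a b m0 mX
  (fun w => hm (W w)) (fun w => ha (W w)) (fun w => hb (W w)).
by rewrite !mulrBr; split; lra.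
Qed.

(** By contradiction: if the deviation [x] exceeded [2 sqrt s], the comparison
    on an interval of length [x] on the appropriate side of [t] would give
    [x^2 / 3 <= s], because [Phi] varies by at most [x / 2] there. The length is
    allowed because [x <= 1]. *)
Lemma kolmogorov_stein_bound (s t : R) :
  (forall f, @stein_class R f ->
    (`| 'E_P[fun w => (f^`()%classic (W w) - W w * f (W w))%R] | <= s%:E)%E) ->
  `|F t - Phi t| <= 2 * Num.sqrt s.
Proof.
move=> steins; rewrite leNgt; apply/negP.
set x := `|F t - Phi t| => sx.
have s0 : 0 <= s.
  by rewrite -lee_fin; exact: le_trans (abse_ge0 _) (steins _ (stein_class0 R)).
have x0 : 0 < x by apply: le_lt_trans sx; rewrite mulr_ge0 ?sqrtr_ge0.
have s_lt : 4 * s < x ^+ 2.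
  have := sqr_sqrtr s0; have := sqrtr_ge0 s; nra.
have F0 : 0 <= F t by rewrite fine_ge0.
have F1 : F t <= 1.
  by rewrite -lee_fin RV_le_fineK probability_le1//; exact: measurable_RV_le.
have x1 : x <= 1.
  by rewrite ler_norml; have := std_cdf_ge0 t; have := std_cdf_le1 t; lra.
have [Fx|Fx] : F t - Phi t = x \/ Phi t - F t = x.
- rewrite /x; have [|/ltW] := leP 0 (F t - Phi t).
    by move/ger0_norm->; left.
  by move/ler0_norm->; right; rewrite opprB.
- have tx : t < t + x <= t + 1 by lra.
  have [H _] := stein_comparison tx steins.
  have := @std_cdf_lipschitz _ t (t + x) (ltW (andP tx).1); nra.
have tx : t - x < t <= t - x + 1 by lra.
have [_ H] := stein_comparison tx steins.
have := @std_cdf_lipschitz _ (t - x) t (ltW (andP tx).1); nra.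
Qed.
End comparison.

Unset Implicit Arguments.
Set Strict Implicit.

Local Open Scope ereal_scope.

Theorem proposition1p1 (R : realType)
    (d : measure_display) (T : measurableType d) (P : probability T R)
    (W : {RV P >-> R})
    (d' : measure_display) (T' : measurableType d') (Q : probability T' R)
    (Z : {RV Q >-> R}) (hZ : standard_normal Z) :
  ereal_sup [set `|P [set w | (W w <= t)%R] - Q [set z | (Z z <= t)%R]|
              | t in [set: R]]
  <= stein_bound W.
Proof.
apply: ge_ereal_sup => _ [t _ <-].
have -> : Q [set z | (Z z <= t)%R] = (Phi t)%:E.
  by rewrite -std_normal_probE -hZ.
rewrite -RV_le_fineK -EFinB abse_EFin /stein_bound.
case: ifP => _; first exact: leey.
set S := ereal_sup _.
have steins f : stein_class f ->
    `| 'E_P[fun w => (f^`()%classic (W w) - W w * f (W w))%R] | <= S.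
  by move=> fS; apply: ereal_sup_ubound; exists f.
(* the supremum is not -oo, since the zero function is a test function *)
case: S steins => [s| |] steins.
- by rewrite /= -EFinM lee_fin; exact: kolmogorov_stein_bound.
- by rewrite /= gt0_muley// leey.
- by have := le_trans (abse_ge0 _) (steins _ (stein_class0 R)).
Qed.
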